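(* Let $n,f,k$ be integers with $1\le f<n$ and $k\ge 1$. If $$k\le\frac{n-1}{n-f},$$ then there is no algorithm that solves $k$-set agreement in a system $\mathcal{M}$ of $n$ processes where - processes are synchronous, - communication is asynchronous, - a process can broadcast a message in an atomic step, and - receiving and sending are part of the same atomic step, even if, of the $f$ possibly faulty processes, $f-1$ can fail by crashing initially and only one process can crash during the execution.
   Context: Processes and runs. $\Pi=\{p_1,\dots,p_n\}$ is a set of $n$ processes with unique ids $1,\dots,n$ communicating by message passing, with messages from a (possibly infinite) universe $M$. Each process has a message buffer containing the messages sent to it but not yet received. Each process $p$ is a deterministic state machine whose local state contains an input (proposal) value $x_p$ from a finite set $V$ with $|V|\ge n$, and a write-once output (decision) value $y_p\in V\cup\{\bot\}$, initially $\bot\notin V$; all other components are initialized to fixed values. In a step, a process atomically takes its current local state and a (possibly empty) subset $L$ of the messages in its buffer and moves to a new local state according to the transition relation; a deterministic message sending function maps the current state and $L$ to a subset of $\Pi\times M$, and each $(q,m)$ in it is sent by placing $m$ in $q$'s buffer. Thus receiving and sending happen in the same atomic step and a message can be sent to all processes in one step (broadcast). No failure detector is available. A configuration is the vector of local states together with all message buffers; initially all processes are in initial states and all buffers are empty. A run is an infinite sequence of configurations starting from an initial configuration, each resulting from the previous one by a legitimate step of a single process. Admissibility. Every correct process takes infinitely many steps; a faulty (crashing) process takes only finitely many steps and may omit sending messages to a subset of the receivers in its very last step; a process that crashes initially (is initially dead) takes no step; every message sent to a correct process is eventually received. Communication is asynchronous: there is no bound on message delays, and messages need not be received in the order in which they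 were sent. Processes are synchronous: there is a constant $\Phi\ge 1$ such that in every contiguous segment of a run in which some process takes $\Phi+1$ steps, every process that has not crashed takes at least one step. $k$-set agreement. An algorithm solves $k$-set agreement if in all its admissible runs: ($k$-Agreement) processes (correct or faulty) decide on at most $k$ different values; (Validity) if a process decides on $v$, then $v$ was proposed by some process; (Termination) every correct process eventually decides, i.e. irrevocably sets its output. *)

(* Defs.v *)
From mathcomp Require Import all_boot all_order all_algebra.
From mathcomp Require Import boolp classical_sets.

Set Implicit Arguments.
Unset Strict Implicit.
Unset Printing Implicit Defensive.

Local Open Scope classical_set_scope.

(* [output = None] stands for y_p = \bot.  [local] gathers all the other
   components of the state. *)
Record local_state (V : finType) (T : Type) := LocalState {
  input : V;
  output : option V;
  local : T
}.

(* A single type [aux] serves all processes; a family of types indexed by the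
   processes embeds into it as a sum.  Behaviour and initial values depend on
   the process.  The received messages are a set, possibly empty. *)
Record algorithm (n : nat) (V : finType) (M : Type) := Algorithm {
  aux : Type;
  aux_init : 'I_n -> aux;
  trans : 'I_n -> local_state V aux -> set M -> local_state V aux;
  send : 'I_n -> local_state V aux -> set M -> set ('I_n * M);
  output_write_once : forall p s L v,
    output s = Some v -> output (trans p s L) = Some v
}.

Section Runs.
Variables (n : nat) (V : finType) (M : Type) (A : algorithm n V M).

Record config := Config {
  state : 'I_n -> local_state V (aux A);
  buffer : 'I_n -> set M
}.

Definition initial (C : config) : Prop :=
  (forall p, output (state C p) = None /\ local (state C p) = aux_init A p) /\
  (forall p, buffer C p = set0).

(* Process [p] receives [L] and omits sending to the receivers in [O]. *)
Definition step (C : config) (p : 'I_n) (L : set M) (O : {set 'I_n})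
    (C' : config) : Prop :=
  [/\ L `<=` buffer C p,
      state C' p = trans p (state C p) L,
      forall q, q != p -> state C' q = state C q
    & forall q, buffer C' q =
        (if q == p then buffer C q `\` L else buffer C q) `|`
        [set m | q \notin O /\ send p (state C p) L (q, m)]].

(* Step [t] is taken by [actor t] and leads from [conf t] to [conf t.+1]. *)
Record run := Run {
  conf : nat -> config;
  actor : nat -> 'I_n;
  received : nat -> set M;
  omitted : nat -> {set 'I_n};
  run_initial : initial (conf 0);
  run_step : forall t,
    step (conf t) (actor t) (received t) (omitted t) (conf t.+1)
}.

Variable r : run.

(* A process crashes with its last step; the run determines the failures. *)
Definition crashed_at (p : 'I_n) (t : nat) : Prop :=
  forall t', t <= t' -> actor r t' <> p.

Definition faulty (p : 'I_n) : Prop := exists t, crashed_at p t.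

Definition correct (p : 'I_n) : Prop :=
  forall t, exists t', t <= t' /\ actor r t' = p.

Definition initially_dead (p : 'I_n) : Prop := crashed_at p 0.

Definition crashes_during (p : 'I_n) : Prop := faulty p /\ ~ initially_dead p.

Definition num_steps (p : 'I_n) (a b : nat) : nat :=
  count (fun t => actor r t == p) (index_iota a b).

(* A process crashing inside the segment takes its last step there, so it is
   enough to speak about the processes not crashed at the end. *)
Definition synchronous_processes (Phi : nat) : Prop :=
  forall (a b : nat) (p : 'I_n), Phi + 1 <= num_steps p a b ->
  forall q, ~ crashed_at q b -> 0 < num_steps q a b.

Definition omission_only_in_last_step : Prop :=
  forall t, omitted r t != finset.set0 -> crashed_at (actor r t) t.+1.

Definition reliable_delivery : Prop :=
  forall p m t, correct p -> buffer (conf r t) p m ->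
  exists t', [/\ t <= t', actor r t' = p & received r t' m].

Definition failure_bound (f : nat) : Prop :=
  #|[pred p | `[< initially_dead p >]]| <= f - 1 /\
  #|[pred p | `[< crashes_during p >]]| <= 1.

(* Delays are unbounded and delivery is unordered: [received] is an arbitrary
   subset of the buffer, subject only to [reliable_delivery]. *)
Definition admissible (Phi f : nat) : Prop :=
  [/\ synchronous_processes Phi, omission_only_in_last_step,
      reliable_delivery & failure_bound f].

Definition proposes (p : 'I_n) (v : V) : Prop := input (state (conf r 0) p) = v.

Definition decides (p : 'I_n) (v : V) : Prop :=
  exists t, output (state (conf r t) p) = Some v.

Definition k_agreement (k : nat) : Prop :=
  #|[pred v | `[< exists p, decides p v >]]| <= k.

Definition validity : Prop :=
  forall p v, decides p v -> exists q, proposes q v.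

Definition termination : Prop :=
  forall p, correct p -> exists v, decides p v.

End Runs.

Definition solves_set_agreement (k : nat) (n : nat) (V : finType) (M : Type)
    (A : algorithm n V M) (adm : run A -> Prop) : Prop :=
  forall r : run A, adm r -> [/\ k_agreement r k, validity r & termination r].

(* Main.v *)
(* Put l = n - f, so that k * l + 1 <= n.  Split the processes into k - 1 blocks
   of size l and a core of at least l + 1 processes.  Running in isolation (with
   one more process that takes a single step, sends nothing and dies, so that at
   most f - 1 processes are initially dead), a block whose members only see the
   input v_i decides v_i.  Delaying all messages between the parts gives a
   failure-free run with the k - 1 values v_i together with every value decided
   in the core, so on inputs from {a, b} the core must reach consensus, although
   one of its processes may crash.  This is refuted by a valence argument.

   With synchronous processes the adversary cannot delay steps, only messages.  A
   crash of q is indistinguishable, for the others, from q taking steps whose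
   messages are delayed.  Hence a value decided after a crash of q at slot T is
   reachable whatever q does from T on.  If every continuation of a
   configuration in which p has received all its pending messages were univalent,
   the value of the crash of the next process to move would not change along any
   execution, and the configuration would be univalent.  So bivalence can be
   preserved while every message gets delivered. *)

Require Import Defs.
From mathcomp Require Import all_boot all_order all_algebra.
From mathcomp Require Import boolp classical_sets zify.

Set Implicit Arguments.
Unset Strict Implicit.
Unset Printing Implicit Defensive.

Local Open Scope classical_set_scope.

(** * Executions on a fixed round-robin of slots *)

Section Slots.
Variable n' : nat.
Local Notation n := n'.+1.

Definition slot_actor (t : nat) : 'I_n := Ordinal (ltn_pmod t (ltn0Sn n')).

Lemma slot_actor_ord (p : 'I_n) : slot_actor p = p.
Proof. by apply: val_inj; rewrite /= modn_small. Qed.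

Lemma slot_actorDn t : slot_actor (t + n) = slot_actor t.
Proof. by apply: val_inj; rewrite /= modnDr. Qed.

Lemma next_slot (p : 'I_n) t : exists2 d, d < n & slot_actor (t + d) = p.
Proof.
exists ((n - t %% n + p) %% n); first exact: ltn_pmod.
apply: val_inj; rewrite /= modnDmr addnA {1}(divn_eq t n).
rewrite -(addnA (t %/ n * n)) subnKC; last by rewrite ltnW ?ltn_pmod.
by rewrite -addnA modnMDl modnDl modn_small.
Qed.

Lemma slot_gap s t : slot_actor s = slot_actor t -> s < t -> s + n <= t.
Proof.
move=> /(congr1 val) /= /eqP st lt_st.
have : n %| t - s by rewrite -eqn_mod_dvd 1?ltnW // eq_sym.
by move=> /dvdn_leq; rewrite subn_gt0 => /(_ lt_st); lia.
Qed.

End Slots.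

Section Executions.
Variables (n' : nat) (V : finType) (M : Type).
Local Notation n := n'.+1.
Variable A : algorithm n V M.

Definition init_config (x : 'I_n -> V) : config A :=
  Config (fun p => LocalState (x p) None (aux_init A p)) (fun _ => set0).

Definition apply_step (C : config A) (p : 'I_n) (L : set M) (o : bool) :
    config A :=
  Config (fun q => if q == p then trans p (state C p) L else state C q)
    (fun q => (if q == p then buffer C q `\` L else buffer C q) `|`
              [set m | ~~ o /\ send p (state C p) L (q, m)]).

(* The configuration before slot [t].  Slot [t] is used by [slot_actor n' t] if
   [al t], and skipped otherwise; [om t] means that all sends are omitted. *)
Fixpoint exec (x : 'I_n -> V) (al om : nat -> bool) (R : nat -> set M)
    (t : nat) : config A :=
  if t is t'.+1 then
    let C := exec x al om R t' in
    let p := slot_actor n' t' in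
    if al t' then apply_step C p (R t' `&` buffer C p) (om t') else C
  else init_config x.

Lemma exec_eq_prefix x al om R al' om' R' t :
    (forall s, s < t -> [/\ al s = al' s, om s = om' s & R s = R' s]) ->
  exec x al om R t = exec x al' om' R' t.
Proof.
elim: t => [//|t IH] E /=.
have [-> -> ->] := E t (leqnn _).
by rewrite IH // => s st; apply: E; rewrite ltnW.
Qed.

Section OneExecution.
Variables (x : 'I_n -> V) (al om : nat -> bool) (R : nat -> set M).
Local Notation sc := (exec x al om R).

Lemma exec_output_stable t t' q v : t <= t' ->
  output (state (sc t) q) = Some v -> output (state (sc t') q) = Some v.
Proof.
move=> /subnKC <-; elim: (t' - t) => [|d IH] H; first by rewrite addn0.
rewrite addnS /=; case: ifP => _; last exact: IH.
rewrite /=; case: eqP => [<-|_]; last exact: IH.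
by apply: output_write_once; apply: IH.
Qed.

Lemma exec_buffer_stable t t' q m : t <= t' -> buffer (sc t) q m ->
  buffer (sc t') q m \/ exists s, [/\ t <= s < t', slot_actor n' s = q & R s m].
Proof.
move=> /subnKC <-; elim: (t' - t) => [|d IH] H; first by left; rewrite addn0.
case: (IH H) => [B|[s [/andP[ts st] sq Rs]]]; last first.
  by right; exists s; split=> //; apply/andP; lia.
rewrite addnS; have [[eq Rm]|NR] :=
  pselect (slot_actor n' (t + d) = q /\ R (t + d) m).
  by right; exists (t + d); split=> //; apply/andP; lia.
left; rewrite /=; case: ifP => _ //=; left.
case: eqP => [e|//]; split=> //= -[Rm _]; apply: NR; split=> //.
Qed.

Lemma exec_skip t t' : t <= t' -> (forall s, t <= s < t' -> ~~ al s) ->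
  sc t' = sc t.
Proof.
move=> /subnKC <-; elim: (t' - t) => [|d IH] H; first by rewrite addn0.
rewrite addnS /= (negbTE (H _ _)) ?IH //; last by apply/andP; lia.
by move=> s /andP[? ?]; apply: H; apply/andP; lia.
Qed.

(** * From slot executions to admissible runs *)

Hypothesis al_mono : forall t t', t <= t' ->
  slot_actor n' t = slot_actor n' t' -> al t' -> al t.
Hypothesis om_last : forall t, al t -> om t -> ~~ al (t + n).
Hypothesis fair : forall p t m, buffer (sc t) p m ->
  exists t', [/\ t <= t', slot_actor n' t' = p & R t' m].
Variables (f Phi k : nat) (q0 : 'I_n).
Hypothesis f_gt0 : 0 < f.
Hypothesis f_ltn : f < n.
Hypothesis Phi_gt0 : 0 < Phi.
Hypothesis few_dead : #|[pred p : 'I_n | ~~ al p]| <= f - 1.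
Hypothesis one_crash : forall t, al (slot_actor n' t) ->
  slot_actor n' t != q0 -> al t.

(** At most [f - 1] processes are initially dead and only [q0] may stop later, which makes fewer
    than [n] in total. *)
Lemma always_alive : exists p, forall t, slot_actor n' t = p -> al t.
Proof.
have : exists p : 'I_n, al p && (p != q0).
  apply/existsP; apply: contraT; rewrite negb_exists => /forallP H.
  suff : n <= #|[pred p : 'I_n | ~~ al p]| + 1 by lia.
  rewrite -[X in X <= _](card_ord n) -(card1 q0) -cardUI.
  apply: leq_trans (leq_addr _ _); apply: subset_leq_card.
  by apply/fintype.subsetP => p _; have := H p; rewrite !inE negb_and negbK.
move=> [p /andP[alp pq]]; exists p => t tp.
by apply: one_crash; rewrite tp.
Qed.

Lemma next_alive t : exists t', (t <= t') && al t'.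
Proof.
have [p Hp] := always_alive; have [d _ dp] := next_slot p t.
by exists (t + d); rewrite leq_addr Hp.
Qed.

Definition next_alive_slot t := ex_minn (next_alive t).

(** A run has no idle steps, so the used slots are enumerated in increasing order, and step [s] of
    the run is slot [alive_slot s]. *)
Fixpoint alive_slot s :=
  if s is s'.+1 then next_alive_slot (alive_slot s').+1 else next_alive_slot 0.

Lemma next_alive_slotP t : [/\ t <= next_alive_slot t, al (next_alive_slot t) &
  forall s, t <= s < next_alive_slot t -> ~~ al s].
Proof.
rewrite /next_alive_slot; case: ex_minnP => m /andP[tm alm] Hm; split=> // s.
by move=> /andP[ts sm]; apply: contraL sm => als; rewrite -leqNgt Hm // ts.
Qed.

Lemma alive_slot_al s : al (alive_slot s).
Proof.
case: s => [|s]; first by case: (next_alive_slotP 0).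
by case: (next_alive_slotP (alive_slot s).+1).
Qed.

Lemma alive_slot_ltS s : alive_slot s < alive_slot s.+1.
Proof. by case: (next_alive_slotP (alive_slot s).+1). Qed.

Lemma alive_slot_mono s s' : (alive_slot s < alive_slot s') = (s < s').
Proof.
have H : {homo alive_slot : i j / i < j}.
  by apply: homo_ltn; [exact: ltn_trans | exact: alive_slot_ltS].
exact: (leqW_mono (leq_mono H)).
Qed.

Lemma alive_slot_leq s s' : (alive_slot s <= alive_slot s') = (s <= s').
Proof. by rewrite leqNgt alive_slot_mono -leqNgt. Qed.

Lemma leq_alive_slot s : s <= alive_slot s.
Proof. by elim: s => // s IH; apply: leq_ltn_trans IH (alive_slot_ltS s). Qed.

Lemma alive_slot_surj t : al t -> exists s, alive_slot s = t.
Proof.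
move=> alt.
have ex : exists s, t <= alive_slot s by exists t; apply: leq_alive_slot.
exists (ex_minn ex); case: ex_minnP => s ts smin.
apply/eqP; rewrite eqn_leq ts andbT leqNgt; apply/negP => lt_ts.
case: s => [|s] in ts smin lt_ts *.
  have [_ _ /(_ t)] := next_alive_slotP 0; rewrite lt_ts alt => /(_ isT); done.
have [_ _ /(_ t)] := next_alive_slotP (alive_slot s).+1.
rewrite lt_ts alt andbT; have := smin s; lia.
Qed.

Lemma exec_alive_slotS s : sc (alive_slot s.+1) = sc (alive_slot s).+1.
Proof.
by have [? _ ?] := next_alive_slotP (alive_slot s).+1; apply: exec_skip.
Qed.

Lemma exec_alive_slot0 : sc (alive_slot 0) = init_config x.
Proof. by have [? _ ?] := next_alive_slotP 0; rewrite (@exec_skip 0). Qed.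

Let cf s := sc (alive_slot s).
Let ac s := slot_actor n' (alive_slot s).
Let rc s := R (alive_slot s) `&` buffer (cf s) (ac s).
Let os s : {set 'I_n} := if om (alive_slot s) then finset.setT else finset.set0.

Lemma exec_run_initial : initial (cf 0).
Proof. by rewrite /cf exec_alive_slot0; split=> p. Qed.

Lemma exec_run_step s : step (cf s) (ac s) (rc s) (os s) (cf s.+1).
Proof.
rewrite /cf exec_alive_slotS /= alive_slot_al; split.
- by move=> m [].
- by rewrite /= eqxx.
- by move=> q /negbTE /= ->.
- move=> q /=; congr (_ `|` _); apply/seteqP; split=> m /=;
  by rewrite /os; case: (om _); rewrite !inE.
Qed.

Definition exec_run : run A := Run exec_run_initial exec_run_step.

Lemma crashed_atP p s : crashed_at exec_run p s ->
  forall t, alive_slot s <= t -> slot_actor n' t = p -> ~~ al t.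
Proof.
move=> H t st tp; apply/negP => /alive_slot_surj [s' e]; rewrite -e in st tp.
by move: st; rewrite alive_slot_leq => /H; apply.
Qed.

Lemma correct_alive p t : correct exec_run p -> slot_actor n' t = p -> al t.
Proof.
move=> /(_ t) [s [ts sp]] tp; apply: (al_mono _ _ (alive_slot_al s)).
  exact: leq_trans ts (leq_alive_slot s).
by rewrite tp.
Qed.

Lemma alive_correct p : (forall t, slot_actor n' t = p -> al t) ->
  correct exec_run p.
Proof.
move=> H s; have [d _ dp] := next_slot p (alive_slot s).
have [s' e] := alive_slot_surj (H _ dp).
by exists s'; rewrite -alive_slot_leq e leq_addr /= /ac e.
Qed.

(** Two steps of one process lie at least [n] slots apart, and any [n] consecutive slots include one
    of [q]. As [q] still moves at or after [b], that slot is used; hence every [Phi >= 1] works. *)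
Lemma exec_run_synchronous : synchronous_processes exec_run Phi.
Proof.
move=> a b p cnt q ncr.
have : 2 <= num_steps exec_run p a b by apply: leq_trans cnt; lia.
rewrite /num_steps -size_filter => sz.
have [s1 [s2 [as1 s12 s2b e1 e2]]] : exists s1 s2,
   [/\ a <= s1, s1 < s2, s2 < b, ac s1 = p & ac s2 = p].
  set l := [seq _ <- _ | _] in sz.
  have srt : sorted ltn l by apply: sorted_filter (iota_ltn_sorted _ _);
    exact: ltn_trans.
  have i1 : nth 0 l 0 \in l by rewrite mem_nth // ltnW.
  have i2 : nth 0 l 1 \in l by rewrite mem_nth.
  exists (nth 0 l 0), (nth 0 l 1).
  move: i1 i2; rewrite /l !mem_filter !mem_index_iota -/l.
  move=> /andP[/eqP ? /andP[? ?]] /andP[/eqP ? /andP[? ?]]; split=> //.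
  by apply: (sorted_ltn_nth ltn_trans) => //; rewrite inE // ltnW.
have gap := slot_gap (etrans e1 (esym e2)).
rewrite alive_slot_mono in gap; have {}gap := gap s12.
have [s3 [bs3 s3q]] : exists s3, b <= s3 /\ ac s3 = q.
  by apply: contrapT => H; apply: ncr => s bs sq; apply: H; exists s.
have [d dn dq] := next_slot q (alive_slot s1).
have lt2 : alive_slot s1 + d < alive_slot s2.
  by apply: leq_trans gap; rewrite ltn_add2l.
have ald : al (alive_slot s1 + d).
  apply: (al_mono _ _ (alive_slot_al s3)); last by rewrite dq.
  by apply: ltnW; apply: leq_trans lt2 _; rewrite alive_slot_leq; lia.
have [s e] := alive_slot_surj ald.
rewrite /num_steps -has_count; apply/hasP; exists s.
  have : s1 <= s by rewrite -alive_slot_leq e leq_addr.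
  have : s < s2 by rewrite -alive_slot_mono e.
  by rewrite mem_index_iota => ? ?; apply/andP; lia.
by rewrite /= /ac e dq.
Qed.

Lemma exec_run_admissible : admissible exec_run Phi f.
Proof.
split; first exact: exec_run_synchronous.
- move=> s /=; rewrite /os; case E: (om _); last by rewrite eqxx.
  move=> _ s' ss' /= e.
  have := om_last (alive_slot_al s) E; apply/negP; rewrite negbK.
  have lt : alive_slot s < alive_slot s' by rewrite alive_slot_mono.
  apply: (al_mono _ _ (alive_slot_al s')); first exact: slot_gap (esym e) lt.
  by rewrite slot_actorDn; apply: esym.
- move=> p m s cp; rewrite /= /cf => Bm.
  (* The earliest suitable slot is taken, since an earlier reception could have removed [m] from the
     buffer. *)
  have ex : exists t,
      (alive_slot s <= t) && ((slot_actor n' t == p) && `[< R t m >]).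
    have [t [st tp Rt]] := fair Bm; exists t.
    by rewrite st tp eqxx /=; apply/asboolP.
  case: (ex_minnP ex) => t /and3P[st /eqP tp /asboolP Rt] tmin.
  have [s' e] := alive_slot_surj (correct_alive cp tp).
  exists s'; split; [by rewrite -alive_slot_leq e|by rewrite /= /ac e|].
  rewrite /= /rc /cf /ac e tp; split=> //.
  case: (exec_buffer_stable st Bm) => // -[u [/andP[su ut] up Ru]].
  have := tmin u; rewrite su up eqxx /= => /(_ (introT (asboolP _) Ru)); lia.
(* Slot [p] is the first slot of process [p], so by [al_mono] skipping it means never moving. *)
- have dead p : ~ initially_dead exec_run p -> al p.
    move=> nd; apply: contrapT => /negP nal; apply: nd => s _ /= e.
    have := al_mono _ _ (alive_slot_al s) => /(_ p).
    move=> H; move: nal; rewrite H //; last by rewrite slot_actor_ord -e.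
    by rewrite -e /= leq_mod.
  split.
    apply: leq_trans few_dead; apply: subset_leq_card.
    apply/fintype.subsetP => p; rewrite !inE => di.
    apply/negP => /alive_slot_surj [s e]; case: (di s (leq0n s)).
    by rewrite /= /ac e slot_actor_ord.
  rewrite -(card1 q0); apply: subset_leq_card.
  apply/fintype.subsetP => p; rewrite !inE => -[[s cs] nd].
  apply: contraT => pq; exfalso.
  have [d _ dp] := next_slot p (alive_slot s).
  have := crashed_atP cs (leq_addr d _) dp.
  by rewrite one_crash // dp ?dead.
Qed.

Lemma exec_solves :
    solves_set_agreement k (fun r : run A => admissible r Phi f) ->
  [/\ #|[pred v | `[< exists p t, output (state (sc t) p) = Some v >]]| <= k,
      forall p t v, output (state (sc t) p) = Some v -> exists q, x q = v &
      forall p, (forall t, slot_actor n' t = p -> al t) ->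
        exists v t, output (state (sc t) p) = Some v].
Proof.
move=> /(_ _ exec_run_admissible) [ka va te]; split.
- apply: leq_trans ka; apply: subset_leq_card.
  apply/fintype.subsetP => v; rewrite !inE => -[p [t e]].
  exists p, t; apply: exec_output_stable e.
  exact: leq_alive_slot.
- move=> p t v e; have [|q Hq] := va p v.
    by exists t; apply: exec_output_stable e; apply: leq_alive_slot.
  exists q; rewrite -Hq /= /cf; have [? _ H] := next_alive_slotP 0.
  by rewrite /= (exec_skip _ H).
- by move=> p /alive_correct /te [v [t e]]; exists v, (alive_slot t).
Qed.

End OneExecution.
End Executions.

(** * Indistinguishability of executions *)

Section Domination.
Variables (n' : nat) (V : finType) (M : Type).
Local Notation n := n'.+1.
Variable A : algorithm n V M.

Definition dominates (W : {set 'I_n}) (C E : config A) : Prop :=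
  forall q, q \in W -> state C q = state E q /\ buffer E q `<=` buffer C q.

(* Buffers are sets without sender identities, so inclusion (and not equality)
   of buffers is what survives additional messages from outside [W]. *)
Lemma dominates_exec (W : {set 'I_n}) x al om R x' al' om' R' T T' : T <= T' ->
    dominates W (exec A x al om R T) (exec A x' al' om' R' T) ->
    (forall t, T <= t < T' ->
       if slot_actor n' t \in W then
         [/\ al t = al' t, om t -> om' t &
             R t = R' t `&` buffer (exec A x' al' om' R' t) (slot_actor n' t)]
       else al' t -> om' t) ->
  dominates W (exec A x al om R T') (exec A x' al' om' R' T').
Proof.
move=> /subnKC <-; elim: (T' - T) => [|d IH] D0 H; first by rewrite addn0.
have {IH} D :
    dominates W (exec A x al om R (T + d)) (exec A x' al' om' R' (T + d)).
  by apply: IH => // t /andP[? ?]; apply: H; apply/andP; lia.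
have {H} := H (T + d); rewrite addnS /= leq_addr ltnSn => /(_ isT).
set C := exec _ _ _ _ _ _ in D *; set E := exec _ _ _ _ _ _ in D *.
set p := slot_actor _ _; case: ifP => pW.
  case=> -> om_om' eR.
  have -> : R (T + d) `&` buffer C p = R' (T + d) `&` buffer E p.
    by rewrite eR -setIA (setIidl (D p pW).2).
  case: ifP => // _ q qW; have [e s] := D q qW; split=> /=.
    by case: eqP => // _; rewrite (D p pW).1.
  move=> m [B|[o S]].
    by left; case: eqP B => [_ [/s ? ?]|_ /s].
  right; split; last by rewrite (D p pW).1.
  by apply: contra o; apply: om_om'.
(* A process outside [W] sends nothing in the dominated execution, and what it sends in the other
   one only enlarges the dominating buffers. *)
move=> silent q qW; have [e s] := D q qW.
have qp : (q == p) = false by apply: contraFF pW => /eqP <-.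
have [-> sE] :
    state (if al' (T + d) then apply_step E p (R' (T + d) `&` buffer E p)
             (om' (T + d)) else E) q = state E q /\
    buffer (if al' (T + d) then apply_step E p (R' (T + d) `&` buffer E p)
              (om' (T + d)) else E) q `<=` buffer E q.
  case: ifP silent => [_ /(_ isT) ->|_ _]; last by split.
  by rewrite /= qp; split=> // m [|[]].
case: ifP => _; last by split=> // m /sE /s.
by rewrite /= qp; split=> // m /sE /s; left.
Qed.

Definition sub_exec (x : 'I_n -> V) (S : {set 'I_n}) (R : nat -> set M) :=
  exec A x (fun t => slot_actor n' t \in S) (fun=> false) R.

(* Nothing is withheld from slot [T] on. *)
Definition cut (R : nat -> set M) (T t : nat) : set M :=
  if t < T then R t else setT.

(* [q] takes its last step, omitting all messages, in its first slot after [T]: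
   a crash right at [T] could be an initial one. *)
Definition crash_exec (x : 'I_n -> V) (S : {set 'I_n}) (q : 'I_n)
    (R : nat -> set M) (T : nat) :=
  exec A x
    (fun t =>
       (slot_actor n' t \in S) && ((slot_actor n' t != q) || (t < T + n)))
    (fun t => (slot_actor n' t == q) && (T <= t)) (cut R T).

Definition agree (T : nat) (R R' : nat -> set M) :=
  forall t, t < T -> R t = R' t.

Lemma agree_sym T R R' : agree T R R' -> agree T R' R.
Proof. by move=> H t /H. Qed.

Lemma agree_trans T R R' R'' : agree T R R' -> agree T R' R'' -> agree T R R''.
Proof. by move=> H H' t tT; rewrite H ?H'. Qed.

Lemma agree_le T T' R R' : T <= T' -> agree T' R R' -> agree T R R'.
Proof. by move=> TT' H t tT; apply: H; apply: leq_trans tT TT'. Qed.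

Lemma agree_cut R T : agree T (cut R T) R.
Proof. by move=> t tT; rewrite /cut tT. Qed.

Lemma eq_cut R R' T : agree T R R' -> cut R T = cut R' T.
Proof. by move=> H; apply/funext => t; rewrite /cut; case: ifP => // /H. Qed.

Lemma sub_exec_agree x S R R' T t : agree T R R' -> t <= T ->
  sub_exec x S R t = sub_exec x S R' t.
Proof.
move=> H tT; apply: exec_eq_prefix => s st; split=> //.
by apply: H; apply: leq_trans st tT.
Qed.

Lemma crash_exec_prefix x S q R T : crash_exec x S q R T T = sub_exec x S R T.
Proof.
apply: exec_eq_prefix => s sT; split; last by rewrite /cut sT.
  by rewrite (ltn_addr _ sT) orbT andbT.
by rewrite leqNgt sT andbF.
Qed.

(** To the others, a crash of [q] looks like a delay of its messages: they receive just what the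
    crash execution holds for them, and [q] may do anything. As [x] and [x'] may differ, this also
    covers a change of the input of [q]. *)
Lemma dominates_crash_exec x x' S q R R' T t : T <= t ->
    dominates (S :\ q) (sub_exec x' S R' T) (sub_exec x S R T) ->
    (forall s, T <= s -> slot_actor n' s \in S :\ q ->
       R' s = buffer (crash_exec x S q R T s) (slot_actor n' s)) ->
  dominates (S :\ q) (sub_exec x' S R' t) (crash_exec x S q R T t).
Proof.
move=> Tt D H; apply: dominates_exec Tt _ _.
  by rewrite -/(crash_exec x S q R T) crash_exec_prefix.
move=> s /andP[Ts _]; case: ifP => [sW|/negbT sW].
  move: (sW); rewrite in_setD1 => /andP[sq sS]; rewrite sq sS; split=> //.
  by rewrite /cut ltnNge Ts /= setTI; apply: H.
by move=> /andP[sS _]; move: sW; rewrite in_setD1 sS andbT negbK Ts andbT.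
Qed.

End Domination.

(** * Preservation of bivalence *)

Section FLP.
Variables (n' : nat) (V : finType) (M : Type).
Local Notation n := n'.+1.
Variable A : algorithm n V M.
Variables (x : 'I_n -> V) (S : {set 'I_n}).
Local Notation sx := (sub_exec A x S).
Local Notation cx := (crash_exec A x S).

Hypothesis crash_decides : forall q R T, exists v t p,
  p \in S :\ q /\ output (state (cx q R T t) p) = Some v.
Hypothesis agreement : forall R t t' p p' v v', p \in S -> p' \in S ->
  output (state (sx R t) p) = Some v ->
  output (state (sx R t') p') = Some v' -> v = v'.
Hypothesis fair_decides : forall R,
    (forall p t m, buffer (sx R t) p m ->
       exists t', [/\ t <= t', slot_actor n' t' = p & R t' m]) ->
  exists v t p, p \in S /\ output (state (sx R t) p) = Some v.

Definition reachable_value (R : nat -> set M) (T : nat) (v : V) : Prop :=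
  exists R', agree T R' R /\
    exists t p, p \in S /\ output (state (sx R' t) p) = Some v.

Definition univalent (R : nat -> set M) (T : nat) : Prop :=
  forall v v', reachable_value R T v -> reachable_value R T v' -> v = v'.

Lemma reachable_value_agree R R' T v : agree T R R' ->
  reachable_value R T v -> reachable_value R' T v.
Proof.
by move=> H [R'' [H' D]]; exists R''; split=> //; apply: agree_trans H' H.
Qed.

(** [cut R T] forgets [R] from slot [T] on, so the chosen value depends only on the history before
    [T]. *)
Definition crash_value (q : 'I_n) (R : nat -> set M) (T : nat) : V :=
  sval (cid (crash_decides q (cut R T) T)).

Lemma crash_value_agree q R R' T : agree T R R' ->
  crash_value q R T = crash_value q R' T.
Proof. by move=> /eq_cut e; rewrite /crash_value e. Qed.

(** The processes of [S] other than [q] imitate the execution in which [q] crashes at [T], while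
    [q], not crashed, receives according to [B]. *)
Definition follow_crash q R T (B : nat -> set M) (t : nat) : set M :=
  if (T <= t) && (slot_actor n' t \in S :\ q)
  then buffer (cx q (cut R T) T t) (slot_actor n' t) else B t.

Lemma follow_crash_agree q R T B :
  agree T B R -> agree T (follow_crash q R T B) R.
Proof. by move=> H t tT; rewrite /follow_crash leqNgt tT; apply: H. Qed.

(** Slot [T] belongs to the process whose crash is imitated, so its reception there stays free. This
    lets a crash value survive one more step. *)
Lemma follow_crash_agreeS R T B : agree T.+1 B R ->
  agree T.+1 (follow_crash (slot_actor n' T) R T B) R.
Proof.
move=> H t tT; have [lt|ge] := ltnP t T.
  by apply: (@follow_crash_agree _ _ T) => //; apply: agree_le H.
have -> : t = T by lia.
by rewrite /follow_crash in_setD1 eqxx andbF; apply: H.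
Qed.

Lemma follow_crash_reachable q R T B T' : agree T B R ->
  reachable_value (follow_crash q R T B) T' (crash_value q R T).
Proof.
move=> BR; exists (follow_crash q R T B); split=> //.
rewrite /crash_value; case: cid => v /= [t [p [pS e]]].
exists (maxn T t), p; split; first by move: pS; rewrite in_setD1 => /andP[].
have D : dominates (S :\ q) (sx (follow_crash q R T B) (maxn T t))
    (cx q (cut R T) T (maxn T t)).
  apply: dominates_crash_exec; first exact: leq_maxl.
    rewrite (sub_exec_agree _ _ _ (follow_crash_agree q BR)) //.
    by rewrite (sub_exec_agree _ _ _ (@agree_cut _ R T)) // => r _; split.
  by move=> s Ts sW; rewrite /follow_crash Ts sW.
have [-> _] := D p pS.
by apply: exec_output_stable e; apply: leq_maxr.
Qed.

(** * Univalence after a flush implies univalence before it *)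

Section Flush.
Variables (R0 : nat -> set M) (T0 : nat) (p : 'I_n).

Definition flushed (R : nat -> set M) (T : nat) : Prop :=
  forall m, buffer (sx R0 T0) p m ->
    exists t, [/\ T0 <= t < T, slot_actor n' t = p & R t m].

Hypothesis flushed_univalent : forall R T, T0 < T -> agree T0 R R0 ->
  flushed R T -> univalent R T.

Local Notation value R T := (crash_value (slot_actor n' T) R T).

(** In slot [T.+1 + e], [p] gets everything: by [cut] if it is [q] or outside [S], and otherwise its
    buffer in the crash execution, which still holds [m] because [p] has no slot in between. *)
Lemma follow_crash_flushed R T e : T0 <= T -> agree T0 R R0 -> e < n ->
    slot_actor n' (T.+1 + e) = p ->
  flushed (follow_crash (slot_actor n' T) R T (cut R T.+1)) (T.+1 + e).+1.
Proof.
move=> T0T RR0 en ep m Bm; set q := slot_actor n' T.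
have BR : agree T (cut R T.+1) R by apply: agree_le (@agree_cut _ R T.+1).
have [inB|[s [/andP[? ?] sp Rs]]] :
    buffer (sx R T) p m \/
    exists s, [/\ T0 <= s < T, slot_actor n' s = p & R s m].
- apply: exec_buffer_stable T0T _.
  by rewrite -/(sx R) (sub_exec_agree _ _ _ RR0).
- exists (T.+1 + e); split=> //; first by apply/andP; lia.
  rewrite /follow_crash ep; case: ifP => [/andP[_ pW]|_]; last first.
    by rewrite /cut ltnNge leq_addr.
  have TTe : T <= T.+1 + e by lia.
  have Bc : buffer (cx q (cut R T) T T) p m.
    by rewrite crash_exec_prefix (sub_exec_agree _ _ _ (@agree_cut _ R T)).
  have [//|[s [/andP[Ts se] sp _]]] := exec_buffer_stable TTe Bc.
  have := slot_gap (etrans sp (esym ep)) se => gap.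
  have sT : s = T by lia.
  by move: pW; rewrite -sp sT in_setD1 eqxx.
- exists s; split=> //; first by apply/andP; lia.
  by rewrite (follow_crash_agree _ BR).
Qed.

(** The schedule [F] performs slot [T] as in [R] and then imitates the crash at [T]. Being flushed,
    it is univalent, yet it reaches both crash values. *)
Lemma value_step_at_flush R T e : T0 <= T -> agree T0 R R0 -> e < n ->
    slot_actor n' (T.+1 + e) = p ->
    (forall R, agree T0 R R0 -> flushed R (T.+1 + e).+1 ->
       reachable_value R (T.+1 + e).+1 (value R T.+1)) ->
  value R T.+1 = value R T.
Proof.
move=> T0T RR0 en ep X.
have cR := @agree_cut _ R T.+1.
set F := follow_crash (slot_actor n' T) R T (cut R T.+1).
have FR : agree T.+1 F R := follow_crash_agreeS cR.
have FR0 : agree T0 F R0.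
  by apply: agree_trans RR0; apply: agree_le FR; apply: leqW.
have flF : flushed F (T.+1 + e).+1 by apply: follow_crash_flushed.
rewrite -(crash_value_agree _ FR).
have T0lt : T0 < (T.+1 + e).+1 by lia.
apply: (flushed_univalent T0lt FR0 flF).
  exact: X.
by apply: follow_crash_reachable; apply: agree_le cR.
Qed.

(** Induction on the distance to the slot of [p]. At distance 0 the crash imitated is that of [p]
    itself, whose reception is free; otherwise the induction hypothesis is the premise of
    [value_step_at_flush]. *)
Lemma flush_reaches_value d R T : d < n -> T0 <= T -> agree T0 R R0 ->
    slot_actor n' (T + d) = p -> flushed R (T + d).+1 ->
  reachable_value R (T + d).+1 (value R T).
Proof.
elim: d R T => [|d IH] R T dn T0T RR0 dp flR.
  rewrite addn0; have RR : agree T.+1 R R by [].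
  apply: reachable_value_agree (follow_crash_agreeS RR) _.
  exact: follow_crash_reachable.
rewrite -addSnnS in dp flR *; have T0T' := leqW T0T.
rewrite -(@value_step_at_flush _ _ d) //; try exact: ltnW.
  by apply: IH => //; apply: ltnW.
by move=> R' ? ?; apply: IH => //; apply: ltnW.
Qed.

Lemma value_const R T : T0 <= T -> agree T0 R R0 -> value R T = value R0 T0.
Proof.
move=> /subnKC <- RR0; elim: (T - T0) => [|d IH].
  by rewrite addn0; apply: crash_value_agree.
rewrite addnS -IH; have [e en ep] := next_slot p (T0 + d).+1.
apply: (@value_step_at_flush _ _ e) => //; first exact: leq_addr.
move=> R' R'R0 fl; apply: flush_reaches_value => //.
by apply: leqW; apply: leq_addr.
Qed.

Lemma flushed_univalent_univalent : univalent R0 T0.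
Proof.
suff H v : reachable_value R0 T0 v -> v = value R0 T0.
  by move=> v v' /H -> /H ->.
move=> [R [RR0 [t [q [qS e]]]]].
(* [T] is a slot of [p] no earlier than the decision at [t] and [T0]. As [cut R T] withholds nothing
   at [T] itself, [p] is flushed at [T.+1], where [v] and the crash value are both reachable. *)
have [d _ dp] := next_slot p (maxn t T0); set T := maxn t T0 + d in dp.
have [tT T0T] : t <= T /\ T0 <= T by lia.
have cR := @agree_cut _ R T.
have cR0 : agree T0 (cut R T) R0 by apply: agree_trans (agree_le T0T cR) RR0.
have fl : flushed (cut R T) T.+1.
  move=> m _; exists T; split=> //; first by rewrite T0T leqnn.
  by rewrite /cut ltnn.
have T0T1 : T0 < T.+1 by lia.
rewrite -(value_const T0T cR0); apply: (flushed_univalent T0T1 cR0 fl).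
  exists (cut R T); split=> //; exists t, q; split=> //.
  by rewrite (sub_exec_agree _ _ _ cR).
have := @flush_reaches_value 0 (cut R T) T; rewrite addn0; exact.
Qed.

End Flush.

Lemma bivalent_extension R0 T0 p : ~ univalent R0 T0 ->
  exists R T, [/\ T0 < T, agree T0 R R0, flushed R0 T0 p R T & ~ univalent R T].
Proof.
move=> biv; apply: contrapT => H; apply: biv.
apply: (@flushed_univalent_univalent _ _ p) => R T T0T RR0 fl.
by apply: contrapT => nu; apply: H; exists R, T.
Qed.

Lemma always_univalent R T : univalent R T.
Proof.
apply: contrapT => biv0.
have /choice [nxt nxtP] : forall c : 'I_n * ((nat -> set M) * nat), exists c',
    ~ univalent c.2.1 c.2.2 ->
    [/\ c.2.2 < c'.2, agree c.2.2 c'.1 c.2.1,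
        flushed c.2.1 c.2.2 c.1 c'.1 c'.2 & ~ univalent c'.1 c'.2].
  move=> [p [R0 T0]] /=; have [u|/(bivalent_extension p) [R' [T' H]]] :=
    pselect (univalent R0 T0); first by exists (R0, T0).
  by exists (R', T').
(* The processes are flushed in round-robin order, so that every message is eventually received. *)
pose st := fix st i :=
  if i is j.+1 then nxt (slot_actor n' j, st j) else (R, T).
have biv i : ~ univalent (st i).1 (st i).2.
  by elim: i => // i /(nxtP (slot_actor n' i, st i)) [].
have stP i := nxtP (slot_actor n' i, st i) (biv i).
have lt_st i : (st i).2 < (st i.+1).2 by case: (stP i).
have le_st : {homo (fun i => (st i).2) : i j / i <= j}.
  apply: homo_leq => [//||i]; [exact: leq_trans | exact: ltnW].
have ge_st i : i <= (st i).2 by elim: i => // i IH; apply: leq_ltn_trans IH _.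
have agr i j : i <= j -> agree (st i).2 (st j).1 (st i).1.
  move=> /subnKC <-; elim: (j - i) => [|d IH]; first by rewrite addn0.
  rewrite addnS; apply: agree_trans IH; case: (stP (i + d)) => _ H _ _.
  by apply: agree_le H; apply: le_st; apply: leq_addr.
(* Stage [t.+1] has settled all slots up to [t], so the diagonal agrees with every stage on the
   slots settled there. *)
pose Rlim t := (st t.+1).1 t.
have agr_lim i : agree (st i).2 Rlim (st i).1.
  move=> t tT; rewrite /Rlim; have [le|lt] := leqP i t.+1.
    exact: agr tT.
  by symmetry; apply: (agr _ _ (ltnW lt)).
have [p t m Bm|v [t [p [pS e]]]] := @fair_decides Rlim.
  have [d _ dp] := next_slot p t; set i := t + d in dp.
  have ti : t <= (st i).2 by apply: leq_trans (ge_st i); apply: leq_addr.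
  have [Bi|[s [/andP[ts _] sp Rs]]] := exec_buffer_stable ti Bm;
    last by exists s.
  rewrite -/(sx Rlim) (sub_exec_agree _ _ _ (agr_lim i)) // in Bi.
  have [_ _ fl _] := stP i; rewrite -dp in Bi.
  have [s [/andP[is_s s_iS] sp Rs]] := fl _ Bi.
  exists s; split; [exact: leq_trans is_s|by rewrite sp|].
  by rewrite (agr_lim i.+1 s s_iS).
(* The limit decides [v] by slot [t], and stage [t] has settled the slots before [t], so every
   extension of that stage decides [v]. *)
apply: (biv t) => v1 v2.
suff H w : reachable_value (st t).1 (st t).2 w -> w = v by move=> /H -> /H ->.
move=> [R' [R'R [t' [p' [p'S e']]]]].
have RR : agree (st t).2 R' Rlim.
  by apply: agree_trans R'R (agree_sym (agr_lim t)).
rewrite -(sub_exec_agree _ _ _ RR) // in e.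
exact: agreement p'S pS e' e.
Qed.

End FLP.

(** * The partitioning argument *)

Section Impossibility.
Variables (n' : nat) (V : finType) (M : Type).
Local Notation n := n'.+1.
Variables (A : algorithm n V M) (f k Phi : nat).
Hypothesis f_gt0 : 0 < f.
Hypothesis f_ltn : f < n.
Hypothesis Phi_gt0 : 0 < Phi.
Hypothesis solves :
  solves_set_agreement k (fun r : run A => admissible r Phi f).

Lemma card_dead (S : {set 'I_n}) : n - f < #|S| ->
  #|[pred p : 'I_n | p \notin S]| <= f - 1.
Proof.
have -> : #|[pred p : 'I_n | p \notin S]| = #|~: S|.
  by apply: eq_card => p; rewrite !inE.
by have := cardsC S; rewrite card_ord; lia.
Qed.

Lemma sub_exec_solves x (S : {set 'I_n}) R : n - f < #|S| ->
    (forall p t m, buffer (sub_exec A x S R t) p m ->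
       exists t', [/\ t <= t', slot_actor n' t' = p & R t' m]) ->
  [/\ #|[pred v | `[< exists p t,
           output (state (sub_exec A x S R t) p) = Some v >]]| <= k,
      forall p t v, output (state (sub_exec A x S R t) p) = Some v ->
        exists q, x q = v &
      exists v t p, p \in S /\ output (state (sub_exec A x S R t) p) = Some v].
Proof.
move=> cardS fair.
(* Nobody crashes during this execution; [ord0] is an arbitrary choice for the process allowed
   to. *)
have [||||ka va te] := @exec_solves n' V M A x (fun t => slot_actor n' t \in S)
    (fun=> false) R _ _ fair f Phi k ord0 f_gt0 f_ltn Phi_gt0 _ _ solves => //.
- by move=> t t' _ ->.
- rewrite -[X in X <= _](_ : #|[pred p : 'I_n | p \notin S]| = _).
    exact: card_dead.
  by apply: eq_card => p; rewrite !inE slot_actor_ord.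
- by move=> t; rewrite slot_actor_ord.
split=> //; have [p pS] : exists p, p \in S.
  by apply/set0Pn; rewrite -card_gt0; lia.
have [t tp|v [t e]] := te p; last by exists v, t, p.
by rewrite tp.
Qed.

Lemma cut_fair R T (C : nat -> config A) p t m : buffer (C t) p m ->
  exists t', [/\ t <= t', slot_actor n' t' = p & cut R T t' m].
Proof.
move=> _; have [d _ dp] := next_slot p (maxn t T).
exists (maxn t T + d); split=> //; first by lia.
by rewrite /cut ltnNge (_ : T <= _) //; lia.
Qed.

Lemma crash_exec_solves x (S : {set 'I_n}) q R T : n - f < #|S| ->
  (forall p t v, output (state (crash_exec A x S q R T t) p) = Some v ->
     exists q, x q = v) /\
  exists v t p, p \in S :\ q /\
    output (state (crash_exec A x S q R T t) p) = Some v.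
Proof.
move=> cardS.
have [||||_ va te] := @exec_solves n' V M A x _ _ _ _ _
  (@cut_fair R T (crash_exec A x S q R T)) f Phi k q f_gt0 f_ltn Phi_gt0
  _ _ solves.
- move=> t t' tt' -> /andP[-> /orP[->//|lt]]; rewrite (leq_ltn_trans tt' lt).
  by rewrite orbT.
- move=> t _ /andP[/eqP tq Tt]; rewrite slot_actorDn tq eqxx /=.
  by rewrite ltn_add2r ltnNge Tt andbF.
- rewrite -[X in X <= _](_ : #|[pred p : 'I_n | p \notin S]| = _).
    exact: card_dead.
  apply: eq_card => p; rewrite !inE slot_actor_ord.
  (* The first slot of [q] is before [T + n], so [q] does not count as initially dead. *)
  have -> : p < T + n by apply: ltn_addl.
  by rewrite orbT andbT.
- by move=> t; rewrite slot_actor_ord => /andP[-> _] ->.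
split=> //; have [p pS] : exists p, p \in S :\ q.
  apply/set0Pn; rewrite -card_gt0; move: cardS; rewrite (cardsD1 q S).
  by move: #|_| => c; case: (q \in S); lia.
have [t tp|v [t e]] := te p; last by exists v, t, p.
by move: pS; rewrite in_setD1 tp => /andP[-> ->].
Qed.

(** * Impossibility of binary consensus within a set [S] *)

Section Consensus.
Variables (S : {set 'I_n}) (a b : V).
Hypothesis card_S : n - f < #|S|.
Hypothesis neq_ab : a <> b.
Hypothesis agreement_S : forall x R t t' p p' v v',
  (forall p, x p = a \/ x p = b) -> p \in S -> p' \in S ->
  output (state (sub_exec A x S R t) p) = Some v ->
  output (state (sub_exec A x S R t') p') = Some v' -> v = v'.

(** The inputs change from all [a] to all [b] one process at a time. Crashing the changed process at
    the start yields one value reachable on both neighbouring inputs, so by univalence [a] is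
    carried to the all-[b] input, against validity. *)
Lemma no_consensus : False.
Proof.
pose x i := fun p : 'I_n => if p < i then b else a.
have xab i p : x i p = a \/ x i p = b by rewrite /x; case: ifP; [right|left].
pose R0 : nat -> set M := fun=> setT.
have fair0 i p t m : buffer (sub_exec A (x i) S R0 t) p m ->
    exists t', [/\ t <= t', slot_actor n' t' = p & R0 t' m].
  by have [d _ dp] := next_slot p t; exists (t + d); rewrite leq_addr.
have val i v : reachable_value A (x i) S R0 0 v -> exists q, x i q = v.
  move=> [R [_ [t [p [_ e]]]]].
  (* Validity is known for fair schedules, so [R] is replaced by one that delivers everything from
     slot [t] on. *)
  have [_ va _] := sub_exec_solves card_S
    (@cut_fair R t (sub_exec A (x i) S (cut R t))).
  by apply: (va p t); rewrite (sub_exec_agree _ _ _ (@agree_cut _ R t)).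
have uni i : univalent A (x i) S R0 0.
  apply: always_univalent.
  - by move=> q R T; case: (crash_exec_solves (x i) q R T card_S).
  - by move=> R t t' p p' v v'; apply: agreement_S.
  - by move=> R /(sub_exec_solves card_S) [].
have P i : i <= n -> reachable_value A (x i) S R0 0 a.
  elim: i => [|i IH] lt_in.
    have [_ _ [v [t [p [pS e]]]]] := sub_exec_solves card_S (fair0 0).
    have R0v : reachable_value A (x 0) S R0 0 v.
      by exists R0; split=> //; exists t, p.
    by have [q xq] := val _ _ R0v; rewrite -xq in R0v.
  pose q := Ordinal lt_in; set E := crash_exec A (x i) S q R0 0.
  have [_ [v [t [p [pS e]]]]] := crash_exec_solves (x i) q R0 0 card_S.
  pose R s :=
    if slot_actor n' s \in S :\ q then buffer (E s) (slot_actor n' s) else setT.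
  have reach y : (forall p, p != q -> y p = x i p) ->
      reachable_value A y S R0 0 v.
    move=> eqy; exists R; split=> //; exists t, p; split.
      by move: pS; rewrite in_setD1 => /andP[].
    have D : dominates (S :\ q) (sub_exec A y S R t) (E t).
      apply: dominates_crash_exec => //; last by move=> s _ sW; rewrite /R sW.
      by move=> r; rewrite in_setD1 => /andP[rq _]; split=> //=; rewrite eqy.
    by have [-> _] := D p pS.
  have va : v = a by apply: (uni i); [exact: reach|apply/IH/ltnW].
  rewrite -va; apply: reach => r rq; rewrite /x ltnS leq_eqVlt.
  have /negbTE -> // : r != i :> nat.
  by apply: contra rq => /eqP ri; apply/eqP/val_inj.
by have [q] := val _ _ (P n (leqnn n)); rewrite /x ltn_ord => /esym.
Qed.

End Consensus.

(** * Partition of the processes into [k'] blocks and a core *)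

Section Partition.
Variable k' : nat.
Hypothesis k_eq : k = k'.+1.
Hypothesis k_small : k * (n - f) < n.
Local Notation l := (n - f).

Definition core : {set 'I_n} := [set p : 'I_n | k' * l <= p].
Definition block (i : nat) : {set 'I_n} :=
  [set p : 'I_n | (p < k' * l) && (p %/ l == i)].

Lemma l_gt0 : 0 < l. Proof. by rewrite subn_gt0. Qed.

Lemma card_core : l < #|core|.
Proof.
have kl : k' * l + l < n by have := k_small; rewrite k_eq mulSn addnC.
have ltk (j : 'I_l.+1) : k' * l + j < n by have := ltn_ord j; lia.
rewrite -[X in X <= _](card_ord l.+1).
rewrite -(card_imset (f := fun j => Ordinal (ltk j)) predT); last first.
  by move=> j1 j2 /(congr1 val) /= /addnI /val_inj.
apply: subset_leq_card; apply/fintype.subsetP => _ /imsetP [j _ ->].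
by rewrite finset.in_set /= leq_addr.
Qed.

Lemma ord_max_core : ord_max \in core.
Proof.
rewrite finset.in_set /=; have := k_small; have := l_gt0.
by rewrite k_eq; lia.
Qed.

Lemma block_core i p : p \in block i -> p \notin core.
Proof. by rewrite !finset.in_set => /andP[lt _]; rewrite -ltnNge. Qed.

(** A block of [l = n - f] processes would leave [f] initially dead; adding [ord_max] brings this
    down to the allowed [f - 1]. *)
Lemma card_block i : i < k' -> l < #|ord_max |: block i|.
Proof.
move=> ik; rewrite cardsU1 (contraL (@block_core i _)) ?ord_max_core //.
rewrite add1n ltnS.
have il : i * l + l <= k' * l by rewrite addnC -mulSn leq_mul2r ik orbT.
have kl : k' * l < n by have := k_small; rewrite k_eq mulSn; lia.
have ltk (j : 'I_l) : i * l + j < n by have := ltn_ord j; lia.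
rewrite -[X in X <= _](card_ord l).
rewrite -(card_imset (f := fun j => Ordinal (ltk j)) predT); last first.
  by move=> j1 j2 /(congr1 val) /= /addnI /val_inj.
apply: subset_leq_card; apply/fintype.subsetP => _ /imsetP [j _ ->].
rewrite finset.in_set /= divnMDl ?l_gt0 // divn_small // addn0 eqxx andbT.
by have := ltn_ord j; lia.
Qed.

Variable vs : nat -> V.
Hypothesis vs_inj : forall i j : 'I_k.+1, vs i = vs j -> i = j.

Lemma core_value x R t p v : (forall p, x p = vs k' \/ x p = vs k) ->
    output (state (sub_exec A x core R t) p) = Some v ->
  v = vs k' \/ v = vs k.
Proof.
move=> xab; rewrite -(sub_exec_agree _ _ _ (@agree_cut _ R t)) // => e.
have [_ va _] := sub_exec_solves card_core
  (@cut_fair R t (sub_exec A x core (cut R t))).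
by have [q <-] := va _ _ _ e.
Qed.

(** With crash slot 0, the core process [ord_max] omits all messages in its only step, so the block
    hears nobody else. *)
Definition block_exec i :=
  crash_exec A (fun=> vs i) (ord_max |: block i) ord_max (fun=> setT) 0.

Lemma block_decides i : i < k' -> exists t p,
  p \in block i /\ output (state (block_exec i t) p) = Some (vs i).
Proof.
move=> /card_block /(crash_exec_solves (fun=> vs i) ord_max (fun=> setT) 0).
move=> [va [v [t [p [pW e]]]]]; exists t, p.
have [_ ->] := va _ _ _ e; split=> //.
by move: pW; rewrite in_setD1 in_setU1 => /andP[/negbTE ->].
Qed.

(* Until slot [Tm] messages between different parts of the partition are
   delayed, so each block and the core behave as if they were alone. *)
Section PartitionedExecution.
Variables (x : 'I_n -> V) (R : nat -> set M) (Tm : nat).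

Definition part_input (p : 'I_n) : V := if p \in core then x p else vs (p %/ l).

Definition part_received (t : nat) : set M :=
  let p := slot_actor n' t in
  if p \in core then R t `&` buffer (sub_exec A x core R t) p
  else buffer (block_exec (p %/ l) t) p.

Definition part_exec := sub_exec A part_input finset.setT (cut part_received Tm).

Lemma part_exec_core t : t <= Tm ->
  dominates core (part_exec t) (sub_exec A x core R t).
Proof.
move=> tT; apply: (@dominates_exec _ _ _ _ core _ _ _ _ _ _ _ _ 0) => //.
  by move=> p pS; split=> //=; rewrite /part_input pS.
move=> s /andP[_ st]; case: ifP => /= [sS|->] //.
rewrite finset.in_setT; split=> //.
by rewrite /cut (leq_trans st tT) /part_received sS.
Qed.

Lemma part_exec_block i t : t <= Tm ->
  dominates (block i) (part_exec t) (block_exec i t).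
Proof.
move=> tT; apply: (@dominates_exec _ _ _ _ (block i) _ _ _ _ _ _ _ _ 0) => //.
  move=> p pB; split=> //=; rewrite /part_input (negbTE (block_core pB)).
  by move: pB; rewrite finset.in_set => /andP[_ /eqP ->].
(* Outside the block, only [ord_max] is active in [block_exec], and it is silent. *)
move=> s /andP[_ st]; case: ifP => sB; rewrite in_setU1 sB; last first.
  by rewrite orbF => /andP[/eqP -> _]; rewrite eqxx.
have sC := block_core sB; rewrite finset.in_setT orbT /=; split=> //.
  by rewrite (contraNneq _ sC) // => ->; apply: ord_max_core.
rewrite /cut (leq_trans st tT) /part_received (negbTE sC) setTI.
by move: sB; rewrite finset.in_set => /andP[_ /eqP ->].
Qed.

End PartitionedExecution.

Lemma core_agreement x R t t' p p' v v' :
    (forall p, x p = vs k' \/ x p = vs k) -> p \in core -> p' \in core ->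
    output (state (sub_exec A x core R t) p) = Some v ->
    output (state (sub_exec A x core R t') p') = Some v' ->
  v = v'.
Proof.
move=> xab pS p'S e e'; apply: contrapT => vv'.
have /choice [tt ttP] : forall i : 'I_k', exists t, exists p,
    p \in block i /\ output (state (block_exec i t) p) = Some (vs i).
  by move=> i; apply: block_decides.
(* The delay outlasts both core decisions and one decision in each block. *)
pose Tm := maxn (maxn t t') (\max_i tt i).
have [tT t'T] : t <= Tm /\ t' <= Tm by lia.
have card_all : l < #|[set: 'I_n]%SET| by rewrite cardsT card_ord; lia.
have [ka _ _] := sub_exec_solves card_all
  (@cut_fair (part_received x R) Tm (part_exec x R Tm)).
have core_dec s r w : s <= Tm -> r \in core ->
    output (state (sub_exec A x core R s) r) = Some w ->
    exists p t, output (state (part_exec x R Tm t) p) = Some w.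
  by move=> sT rS er; exists r, s; rewrite (part_exec_core x R sT rS).1.
have dec_v := core_dec _ _ _ tT pS e; have dec_v' := core_dec _ _ _ t'T p'S e'.
have dec (i : 'I_k.+1) : exists p t,
    output (state (part_exec x R Tm t) p) = Some (vs i).
  have [ik|ik] := ltnP i k'.
    have [r [rB er]] := ttP (Ordinal ik); exists r, (tt (Ordinal ik)).
    have tiT : tt (Ordinal ik) <= Tm.
      by rewrite leq_max (leq_bigmax (F := tt)) orbT.
    by rewrite (part_exec_block x R tiT rB).1.
  (* The two last values are those decided in the core, in one order or the other, since [v] and
     [v'] differ. *)
  have : i = k' :> nat \/ i = k :> nat by have := ltn_ord i; lia.
  case=> ->; case: (core_value xab e) => ve;
    case: (core_value xab e') => ve';
    by first [by case: vv'; rewrite ve ve' | by rewrite -ve | by rewrite -ve'].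
suff : k.+1 <= k by rewrite ltnn.
apply: leq_trans ka; rewrite -[X in X <= _](card_ord k.+1).
rewrite -(card_imset (f := fun i : 'I_k.+1 => vs i) predT) //.
apply: subset_leq_card; apply/fintype.subsetP => _ /imsetP [i _ ->].
by rewrite inE; apply: dec.
Qed.

End Partition.

Lemma no_algorithm : k * (n - f) < n -> n <= #|V| -> 0 < k -> False.
Proof.
move=> k_small card_V k_gt0.
have k_eq : k = k.-1.+1 by rewrite prednK.
have kV : k < #|V|.
  apply: leq_trans card_V; apply: leq_trans k_small.
  by rewrite ltnS leq_pmulr // subn_gt0.
have [v0 _] : exists v0 : V, v0 \in V.
  by apply/card_gt0P; apply: leq_trans kV.
(* [v0] is a mere default: only indices up to [k], which is below [#|V|], matter. *)
pose vs := nth v0 (enum V).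
have vs_inj (i j : 'I_k.+1) : vs i = vs j -> i = j.
  move=> /eqP; rewrite nth_uniq ?enum_uniq -?cardE //.
  - by move=> /eqP/val_inj.
  - exact: leq_trans (ltn_ord i) kV.
  - exact: leq_trans (ltn_ord j) kV.
have neq : vs k.-1 <> vs k.
  have ik : k.-1 < k.+1 by lia.
  by move=> /(vs_inj (Ordinal ik) ord_max) /(congr1 val) /=; lia.
exact: no_consensus (card_core k_eq k_small) neq
  (core_agreement k_eq k_small vs_inj).
Qed.

End Impossibility.

Theorem theorem2 (n f k Phi : nat) (V : finType) (M : Type) :
  1 <= f -> f < n -> 1 <= k ->
  (k%:R <= (n%:R - 1) / (n%:R - f%:R) :> rat)%R ->
  n <= #|V| -> 1 <= Phi ->
  ~ exists A : algorithm n V M,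
      solves_set_agreement k (fun r : run A => admissible r Phi f).
Proof.
case: n => [//|n'] f_gt0 f_ltn k_gt0 k_le card_V Phi_gt0 [A solves].
apply: (no_algorithm f_gt0 f_ltn Phi_gt0 solves) => //.
(* Clearing the positive denominator turns the bound into [k * (n - f) <= n - 1] over the
   naturals. *)
move: k_le; rewrite -GRing.natrB ?(ltnW f_ltn) // -(GRing.natrB _ (ltn0Sn n')).
rewrite Num.Theory.ler_pdivlMr ?Num.Theory.ltr0n ?subn_gt0 //.
by rewrite -GRing.natrM Num.Theory.ler_nat; lia.
Qed.
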